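(* Let $M$ be a paving matroid of rank $r$ with ground set $[n]$. Then $$\mathsf{ehr}_M(t)\preceq \mathsf{ehr}_{U_{r,n}}(t).$$
   Context: For a matroid $M$ with ground set $[n]=\{1,\dots,n\}$, its matroid (base) polytope $\mathcal{P}_M\subset\mathbb{R}^n$ is the convex hull of the indicator vectors of the bases of $M$. For a lattice polytope $P\subset\mathbb{R}^d$, its Ehrhart polynomial is the polynomial in $t$ that agrees with $|tP\cap\mathbb{Z}^d|$ for all integers $t\ge 0$; $\mathsf{ehr}_M(t)$ denotes the Ehrhart polynomial of $\mathcal{P}_M$. A matroid of rank $r$ is paving if every circuit has cardinality at least $r$. $U_{r,n}$ is the uniform matroid of rank $r$ on $[n]$ (its bases are all $r$-element subsets of $[n]$). For polynomials $p(t),q(t)$, $p(t)\preceq q(t)$ means that for every $d\ge 0$ the coefficient of $t^d$ in $p$ is at most the coefficient of $t^d$ in $q$. *)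

(* Defs.v *)
From mathcomp Require Import all_boot all_order all_algebra.
From mathcomp Require Import all_classical all_reals.
From mathcomp Require Import convex.

Set Implicit Arguments.
Unset Strict Implicit.
Unset Printing Implicit Defensive.

Import Order.TTheory GRing.Theory Num.Theory.

Local Open Scope classical_set_scope.
Local Open Scope card_scope.
Local Open Scope ring_scope.

(* The ground set [n] is represented by 'I_n = {0, ..., n-1}. *)
Record matroid (n : nat) := Matroid {
  bases : {set {set 'I_n}};
  bases_neq0 : bases != finset.set0;
  bases_exchange : forall A B : {set 'I_n}, A \in bases -> B \in bases ->
    forall x, x \in A :\: B ->
    exists2 y, y \in B :\: A & (y |: (A :\ x))%SET \in bases
}.

Section MatroidTheory.
Context (n : nat).
Implicit Types (M : matroid n) (A C : {set 'I_n}).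

Definition independent M A := [exists B in bases M, A \subset B].

Definition circuit M C := minset (fun A => ~~ independent M A) C.

(* All bases have the same cardinality, so the maximum is the common value. *)
Definition mrank M : nat := \max_(B in bases M) #|B|.

Definition paving M := forall C, circuit M C -> (mrank M <= #|C|)%N.

Lemma mrank_bound M r : mrank M = r -> (r <= n)%N.
Proof.
move=> <-; apply/bigmax_leqP => B _.
by rewrite -[X in (_ <= X)%N](card_ord n) max_card.
Qed.

End MatroidTheory.

Section Uniform.
Context (r n : nat) (r_le_n : (r <= n)%N).

Definition uniform_bases : {set {set 'I_n}} :=
  finset (fun A : {set 'I_n} => #|A| == r).

Fact uniform_bases_neq0 : uniform_bases != finset.set0.
Proof.
by rewrite -card_gt0 card_draws card_ord bin_gt0.
Qed.

Fact uniform_bases_exchange (A B : {set 'I_n}) :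
  A \in uniform_bases -> B \in uniform_bases ->
  forall x, x \in A :\: B ->
  exists2 y, y \in B :\: A & (y |: (A :\ x))%SET \in uniform_bases.
Proof.
rewrite !inE => /eqP cA /eqP cB x; rewrite inE => /andP[xB xA].
have /card_gt0P[y yBA] : (0 < #|B :\: A|)%N.
  have : (0 < #|A :\: B|)%N by apply/card_gt0P; exists x; rewrite inE xB.
  by rewrite !cardsD finset.setIC cA cB.
exists y => //; move: yBA; rewrite !inE => /andP[yA _].
by rewrite cardsU1 !inE (negbTE yA) andbF -cA (cardsD1 x A) xA.
Qed.

Definition uniform_matroid : matroid n :=
  Matroid uniform_bases_neq0 uniform_bases_exchange.

End Uniform.

Section Ehrhart.
Context (R : realType) (n : nat).

Definition convex_hull (A : set 'rV[R]_n) : set 'rV[R]_n :=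
  smallest (@convex_set R 'rV[R]_n) A.

Definition indicator (A : {set 'I_n}) : 'rV[R]_n := \row_i (i \in A)%:R.

Definition base_polytope (M : matroid n) : set 'rV[R]_n :=
  convex_hull [set indicator B | B in [set` bases M]].

Definition lattice_points (P : set 'rV[R]_n) (t : nat) : set 'rV[R]_n :=
  [set t%:R *: x | x in P] `&` [set y | y \is a mxOver Num.int].

Definition is_ehrhart_poly (P : set 'rV[R]_n) (p : {poly R}) : Prop :=
  forall t : nat, exists2 k : nat,
    lattice_points P t #= `I_k & p.[t%:R] = k%:R.

(* The value 0 is only taken when no such polynomial exists, which Ehrhart's
   theorem excludes for lattice polytopes. *)
Definition ehrhart_poly (P : set 'rV[R]_n) : {poly R} :=
  xget 0 [set p | is_ehrhart_poly P p].

Definition ehr (M : matroid n) : {poly R} := ehrhart_poly (base_polytope M).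

Lemma is_ehrhart_poly_unique P p q :
  is_ehrhart_poly P p -> is_ehrhart_poly P q -> p = q.
Proof.
move=> hp hq; apply/eqP; rewrite -subr_eq0; apply/eqP.
apply: (@roots_geq_poly_eq0 _ _ [seq t%:R | t <- iota 0 (size (p - q)).+1]).
- apply/allP => _ /mapP[t _ ->]; rewrite rootE hornerD hornerN subr_eq0.
  have [k Pk ->] := hp t; have [l Pl ->] := hq t.
  suff -> : k = l by [].
  by apply/card_eq_II; apply: card_eq_trans Pl; rewrite card_eq_sym.
- rewrite map_inj_uniq ?iota_uniq //; by move=> a b /eqP; rewrite eqr_nat => /eqP.
- by rewrite size_map size_iota.
Qed.

Lemma ehrhart_polyE P p : is_ehrhart_poly P p -> ehrhart_poly P = p.
Proof.
by move=> hp; exact: (is_ehrhart_poly_unique (xgetPex 0 (ex_intro _ p hp)) hp).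
Qed.

End Ehrhart.

Definition coef_le (R : realType) (p q : {poly R}) : Prop :=
  forall d : nat, p`_d <= q`_d.

(* Main.v *)
(** The lattice points of the t-th dilate of a paving matroid polytope are
    those of the hypersimplex, minus one slice [y(H) > t(r - 1)] for every
    stressed hyperplane [H]; since two such hyperplanes meet in at most [r - 2]
    elements, the slices are disjoint.  So it suffices that the number of lattice
    points of a slice is a polynomial in [t] with nonnegative coefficients.

    For [|H| = s] and [n - s = m + 1], put [X] for the variable marking [r] and
    [v] for the variable marking [s], and let [G = 1/(1 - v)] and
    [q = (1 - X v)/(1 - v)].  The generating function of the slices is
    [v G V] up to a factor [X], where [V = G E S], [E = (1 - X)/(1 - X q^t)] and
    [S = sum_(k < t) C(k + m, m) q^(t-1-k)].  The series [E] and [V] satisfy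
      [(1 - X v) E' = t G E (E - 1 + X)],
      [v (1 - X v) V' + (m + 1) V
         = t C(t + m, m) E G + t v G E V + X v V],
    and [E = 1 + O(v)], so comparing coefficients of powers of [v] produces their
    coefficients recursively as polynomials in [X] and [t] without subtraction. *)
From HB Require Import structures.
Require Import Defs.
From mathcomp Require Import all_boot all_order all_algebra.
From mathcomp Require Import all_classical all_reals.
From mathcomp Require Import convex interval_inference ring zify.

Set Implicit Arguments.
Unset Strict Implicit.
Unset Printing Implicit Defensive.

Import Order.TTheory GRing.Theory Num.Theory.

(** * Families of sets with small pairwise intersections *)

Lemma exists_subset_card (T : finType) (A C : {set T}) r :
  A \subset C -> #|A| <= r -> r <= #|C| ->
  exists S : {set T}, [/\ A \subset S, S \subset C & #|S| = r].
Proof.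
move=> sAC; elim: r => [|r IH] leAr lerC.
  by exists A; split=> //; apply/eqP; rewrite -leqn0.
move: leAr; rewrite leq_eqVlt => /orP[/eqP cA|ltAr]; first by exists A.
have [S [sAS sSC cS]] := IH ltAr (ltnW lerC).
have /card_gt0P[y] : 0 < #|C :\: S| by rewrite cardsDS // subn_gt0 cS.
rewrite inE => /andP[yS yC]; exists (y |: S); split.
- by rewrite (fintype.subset_trans sAS) ?subsetU1.
- by rewrite finset.subUset finset.sub1set yC.
- by rewrite cardsU1 yS cS.
Qed.

Lemma sum_swap t l l' (F : nat -> nat) a b : l < t -> l' < t -> l != l' ->
  \sum_(k < t) (if k == l :> nat then a else if k == l' :> nat then b else F k)
    + (F l + F l') = \sum_(k < t) F k + (a + b).
Proof.
move=> lt l't nll'.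
rewrite (bigD1 (Ordinal lt)) //= [in RHS](bigD1 (Ordinal lt)) //= eqxx.
have n' : Ordinal l't != Ordinal lt by rewrite -val_eqE eq_sym.
rewrite (bigD1 (Ordinal l't)) //= [in RHS](bigD1 (Ordinal l't)) //=.
rewrite eqxx eq_sym (negPf nll').
rewrite (eq_bigr (fun k : 'I_t => F k)); first by lia.
by move=> k /andP[]; rewrite -!val_eqE /= => /negPf -> /negPf ->.
Qed.

Section SparseFamily.
Variables (n r : nat) (HH : {set {set 'I_n}}).
Hypothesis HHsep : forall H K, H \in HH -> K \in HH -> H != K ->
  #|H :&: K|.+1 < r.
Implicit Types (A B H : {set 'I_n}) (f : 'I_n -> nat).

(** With the stressed sets of a paving matroid as [HH] these are its bases; with [HH] empty, those
    of the uniform matroid. *)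
Definition sparse_basis B := (#|B| == r) && [forall H in HH, ~~ (B \subset H)].

Lemma sparse_sep H K A : H \in HH -> K \in HH -> A \subset H -> A \subset K ->
  r <= #|A|.+1 -> H = K.
Proof.
move=> HHH HHK AH AK leA; apply/eqP; apply: contraT => neq.
have := HHsep HHH HHK neq; rewrite ltnNge => /negP[]; apply: leq_trans leA _.
by rewrite ltnS subset_leq_card // finset.subsetI AH.
Qed.

Lemma not_sparse_basis B : #|B| = r -> ~~ sparse_basis B ->
  exists2 H, H \in HH & B \subset H.
Proof.
move=> cB; rewrite /sparse_basis cB eqxx /= negb_forall => /existsP[H].
by rewrite negb_imply negbK => /andP[HH1 sBH]; exists H.
Qed.

Lemma sum_mem_card t (B : nat -> {set 'I_n}) (H : {set 'I_n}) :
  \sum_(i in H) \sum_(l < t) (i \in B l) = \sum_(l < t) #|B l :&: H|.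
Proof.
rewrite exchange_big; apply: eq_bigr => l _.
rewrite -sum1_card big_mkcond [RHS]big_mkcond; apply: eq_bigr => i _.
by rewrite inE andbC; do 2!case: (_ \in _).
Qed.

(** The [r]-sets are peeled off one at a time: the next one must contain every [i] where [f i]
    attains its bound and lie in the support of [f]. *)
Lemma card_decomposition t f : (forall i, f i <= t) -> \sum_i f i = t * r ->
  exists2 B : nat -> {set 'I_n}, forall l, l < t -> #|B l| = r
    & forall i, f i = \sum_(l < t) (i \in B l).
Proof.
elim: t f => [|t IH] f lef sumf.
  exists (fun=> finset.set0) => // i; rewrite big_ord0; apply/eqP.
  by rewrite -leqn0 lef.
pose A := [set i | f i == t.+1]; pose C := [set i | 0 < f i].
have AC : A \subset C by apply/fintype.subsetP => i; rewrite !inE => /eqP ->.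
(* The total [t.+1 * r] is at least [t.+1 * #|A|] and at most [t.+1 * #|C|]. *)
have [] := @exists_subset_card _ A C r AC.
- rewrite -(leq_pmul2l (ltn0Sn t)) -sumf mulnC -sum_nat_const big_mkcond.
  by apply: leq_sum => i _; rewrite inE; case: eqP => // ->.
- rewrite -(leq_pmul2l (ltn0Sn t)) -sumf mulnC -sum_nat_const [leqRHS]big_mkcond.
  by apply: leq_sum => i _; rewrite inE; case: ltnP => // /leq_trans->.
move=> S [AS SC cS].
have le1f i : (i \in S) <= f i.
  by case: (boolP (i \in S)) => // /(fintype.subsetP SC); rewrite inE.
have [] := IH (fun i => f i - (i \in S)).
- move=> i; have := lef i; rewrite leq_eqVlt => /orP[/eqP fi|]; last by lia.
  by rewrite (fintype.subsetP AS) ?inE ?fi //; lia.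
- have : \sum_i (f i - (i \in S)) + \sum_i (i \in S) = t.+1 * r.
    by rewrite -big_split -sumf; apply: eq_bigr => i _ /=; rewrite subnK.
  have -> : \sum_i (i \in S) = r by rewrite -cS -sum1_card [RHS]big_mkcond.
  by rewrite mulSn addnC => /addnI.
move=> B cB fB; exists (fun l => if l == t then S else B l).
  by move=> l; rewrite ltnS leq_eqVlt; case: eqP => //= _ /cB.
move=> i; rewrite big_ord_recr /= eqxx -(subnK (le1f i)) fB; congr (_ + _).
by apply: eq_bigr => l _; rewrite ltn_eqF.
Qed.

(* Since [A] is contained in [H] and [B] has two elements outside [H], any [y] in
   [B] outside [H] works, and if no [x] did, [A] would lie in a second member. *)
Lemma basis_swap A B H : #|A| = r -> #|B| = r -> H \in HH -> A \subset H ->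
  #|B :&: H|.+1 < r ->
  exists x y, [/\ x \in A :\: B, y \in B :\: A,
    sparse_basis (y |: (A :\ x)) & sparse_basis (x |: (B :\ y))].
Proof.
move=> cA cB HHH AH BH.
have /card_gt0P[y] : 0 < #|B :\: H| by have := cardsID H B; lia.
rewrite inE => /andP[yH yB].
have yA : y \notin A by apply: contra yH; exact: fintype.subsetP.
have cD a b (D : {set 'I_n}) : #|D| = r -> a \in D -> b \notin D ->
    #|D :\ a|.+1 = r /\ #|b |: (D :\ a)| = r.
  move=> cD aD bD; have := cardsD1 a D; rewrite aD cD add1n => ->; split=> //.
  by rewrite cardsU1 !inE (negPf bD) andbF.
have [x xAB xbas] : exists2 x, x \in A :\: B & sparse_basis (x |: (B :\ y)).
  apply/exists_inP; apply: contraT; rewrite negb_exists => /forallP nob.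
  have K x : x \in A :\: B -> exists2 H', H' \in HH & x |: (B :\ y) \subset H'.
    move=> xAB; have := nob x; rewrite xAB /=; apply: not_sparse_basis.
    by move: xAB; rewrite inE => /andP[xB _]; case: (cD y x B).
  have cBy : #|B :\ y|.+1 = r by rewrite -cB (cardsD1 y B) yB.
  have /card_gt0P[x0 x0AB] : 0 < #|A :\: B|.
    have := cardsID B A; have : #|A :&: B| < r; last by lia.
    rewrite -cB; apply: proper_card; rewrite properE subsetIr /=.
    by apply/fintype.subsetPn; exists y; rewrite // inE (negPf yA).
  have [K0 K0H K0sub] := K _ x0AB.
  have ByK0 : B :\ y \subset K0 by apply: fintype.subset_trans K0sub;
    exact: subsetU1.
  have AK0 : A \subset K0.
    apply/fintype.subsetP => a aA; case: (boolP (a \in B)) => aB.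
      by apply: (fintype.subsetP ByK0); rewrite !inE aB andbT;
        apply: contraNneq yA => <-.
    have [|K1 K1H K1sub] := K a; first by rewrite inE aB.
    rewrite (@sparse_sep K0 K1 (B :\ y)) ?cBy //.
      by apply: (fintype.subsetP K1sub); rewrite !inE eqxx.
    by apply: fintype.subset_trans K1sub; exact: subsetU1.
  have K0E : K0 = H by apply: (@sparse_sep _ _ A); rewrite ?cA.
  have : #|B :\ y| <= #|B :&: H|.
    by apply: subset_leq_card; rewrite finset.subsetI subsetDl -K0E.
  by lia.
exists x, y; split=> //; first by rewrite inE yA.
move: xAB; rewrite inE => /andP[xB xA].
have [cAx cyA] := cD x y A cA xA yA.
apply: contraT => /(not_sparse_basis cyA)[K KH Ksub].
have KE : H = K.
  apply: (@sparse_sep _ _ (A :\ x)); rewrite ?cAx //.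
    by apply: fintype.subset_trans AH; exact: subsetDl.
  by apply: fintype.subset_trans Ksub; exact: subsetU1.
by case/negP: yH; rewrite KE (fintype.subsetP Ksub) // !inE eqxx.
Qed.

(** Starting from any decomposition into [r]-sets, the number of non-bases is lowered: a non-basis
    lies in some [H], another part meets [H] in at most [r - 2] elements, and [basis_swap] turns
    both into bases. *)
Lemma basis_decomposition t f : (forall i, f i <= t) -> \sum_i f i = t * r ->
  (forall H, H \in HH -> \sum_(i in H) f i + t <= t * r) ->
  exists2 B : nat -> {set 'I_n}, forall l, l < t -> sparse_basis (B l)
    & forall i, f i = \sum_(l < t) (i \in B l).
Proof.
move=> lef sumf Hf; have [B cB fB] := card_decomposition lef sumf.
have [m] := ubnP (\sum_(l < t) ~~ sparse_basis (B l)).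
elim: m => // m IH in B cB fB *; rewrite ltnS => lem.
have [/forallP allb|] := boolP [forall l : 'I_t, sparse_basis (B l)].
  by exists B => // l ltl; exact: (allb (Ordinal ltl)).
rewrite negb_forall => /existsP[l nbl].
have [H HHH BlH] := not_sparse_basis (cB l (ltn_ord l)) nbl.
have sumH : \sum_(k < t) #|B k :&: H| + t <= t * r.
  by rewrite -sum_mem_card -(eq_bigr _ (fun i _ => fB i)); exact: Hf.
(* Otherwise all parts meet [H] in at least [r - 1] elements and [B l] in [r], so the sum over [H]
   exceeds [t * r - t]. *)
have [k ltk] : exists k : 'I_t, #|B k :&: H|.+1 < r.
  apply/existsP; apply: contraT; rewrite negb_exists => /forallP big.
  have : \sum_(k < t) r < \sum_(k < t) #|B k :&: H|.+1.
    rewrite [ltnLHS](bigD1 l) // [ltnRHS](bigD1 l) //= -addSn leq_add //.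
      by rewrite (finset.setIidPl BlH) cB.
    by apply: leq_sum => k _; rewrite leqNgt.
  under [ltnRHS]eq_bigr do rewrite -addn1.
  by rewrite big_split /= !sum_nat_const card_ord muln1 ltnNge sumH.
have nlk : l != k :> nat.
  by apply: contraTneq ltk => <-; rewrite (finset.setIidPl BlH) cB // -leqNgt.
have [x [y [xlk ykl bl bk]]] :=
  basis_swap (cB l (ltn_ord l)) (cB k (ltn_ord k)) HHH BlH ltk.
set Bl := y |: _ in bl; set Bk := x |: _ in bk.
apply: (IH (fun j =>
  if j == l :> nat then Bl else if j == k :> nat then Bk else B j)).
- move=> j ltj; case: eqP => _; first by case/andP: bl => /eqP.
  by case: eqP => _; [case/andP: bk => /eqP|exact: cB].
- move=> i; rewrite fB.
  have := sum_swap (fun j => i \in B j : nat) (i \in Bl) (i \in Bk)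
    (ltn_ord l) (ltn_ord k) nlk.
  have -> : (i \in Bl) + (i \in Bk) = (i \in B l) + (i \in B k).
    rewrite /Bl /Bk !inE; move: xlk ykl; rewrite !inE.
    case: (eqVneq i x) => [->|_]; case: (eqVneq _ y) => [->|_] //=.
    - by move=> /andP[/negPf -> ->] /andP[].
    - by move=> /andP[/negPf -> ->].
    - by move=> _ /andP[/negPf -> ->].
  move/addIn => <-; apply: eq_bigr => j _.
  by case: eqP => // _; case: eqP.
- have := sum_swap (fun j => ~~ sparse_basis (B j) : nat) 0 0
    (ltn_ord l) (ltn_ord k) nlk.
  rewrite nbl addn0; set S := (\sum_(j < t) _).
  have -> : S = \sum_(j < t) ~~ sparse_basis (if j == l :> nat then Bl
     else if j == k :> nat then Bk else B j).
    apply: eq_bigr => j _; case: eqP => _; first by rewrite bl.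
    by case: eqP => _ //; rewrite bk.
  by lia.
Qed.
End SparseFamily.

(** * Stressed hyperplanes of a paving matroid *)

Section StressedHyperplanes.
Variables (n : nat) (M : matroid n).
Implicit Types (A B H I : {set 'I_n}).

(** Each exchange keeps the size of [A] and shrinks [A :\: B]. *)
Lemma leq_card_bases A B : A \in bases M -> B \in bases M -> #|A| <= #|B|.
Proof.
have [m] := ubnP #|A :\: B|; elim: m A => // m IH A; rewrite ltnS => leAB AM BM.
have [/subset_leq_card//|/fintype.subsetPn[x xA xB]] := boolP (A \subset B).
have xAB : x \in A :\: B by rewrite inE xB.
have [y] := bases_exchange AM BM xAB; rewrite inE => /andP[yA yB] A'M.
have -> : #|A| = #|y |: (A :\ x)|.
  by rewrite cardsU1 !inE (negPf yA) andbF (cardsD1 x A) xA.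
apply: IH A'M BM; apply: leq_trans leAB; apply: proper_card.
rewrite properE; apply/andP; split.
  apply/fintype.subsetP => z; rewrite !inE => /andP[zB /orP[/eqP zy|/andP[_ ->]]].
    by rewrite zy yB in zB.
  by rewrite zB.
by apply/fintype.subsetPn; exists x; rewrite // !inE xB eqxx /= orbF;
  apply: contraNneq yA => <-.
Qed.

Lemma card_basis B : B \in bases M -> #|B| = mrank M.
Proof.
move=> BM; apply/eqP; rewrite eqn_leq leq_bigmax_cond //=.
by apply/bigmax_leqP => A AM; exact: leq_card_bases.
Qed.

Lemma paving_independent I : paving M -> #|I| < mrank M -> independent M I.
Proof.
move=> pM ltI; apply: contraLR ltI => depI; rewrite -leqNgt.
have [C] := @minset_exists _ (fun A => ~~ independent M A) I depI.
by move=> /pM leC /subset_leq_card; exact: leq_trans.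
Qed.

Definition basis_free A := [forall B in bases M, ~~ (B \subset A)].

(** Maximal basis-free sets are the hyperplanes of [M]; those with fewer than [mrank M] elements
    exclude no set of that size. *)
Definition stressed : {set {set 'I_n}} :=
  [set H | maxset basis_free H & mrank M <= #|H|].

Lemma stressed_basis_free H B : H \in stressed -> B \in bases M ->
  ~~ (B \subset H).
Proof. by rewrite inE => /andP[/maxsetp/forall_inP Hfree _] /Hfree. Qed.

(** Otherwise some [I] of size [mrank M - 1] in the intersection extends to a basis by an [x]
    outside [H :|: K]. Exchanging [x] against a basis inside the union would put a basis [y |: I]
    inside [H] or [K]; so the union is basis-free, and by maximality both sets equal it. *)
Lemma stressed_sep H K : paving M -> H \in stressed -> K \in stressed ->
  H != K -> #|H :&: K|.+1 < mrank M.
Proof.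
move=> pM HS KS; apply: contraNltn => leI.
have /set0Pn[B1 B1M] := bases_neq0 M.
have r_gt0 : 0 < mrank M.
  rewrite lt0n -(card_basis B1M) cards_eq0.
  by apply: contraNneq (stressed_basis_free HS B1M) => ->; exact: finset.sub0set.
have [||I [_ IHK cI]] :=
  @exists_subset_card _ finset.set0 (H :&: K) (mrank M).-1 (finset.sub0set _).
- by rewrite cards0.
- by rewrite -ltnS prednK.
have /exists_inP[B0 B0M IB0] : independent M I.
  by apply: paving_independent; rewrite // cI prednK.
have [IH IK] : I \subset H /\ I \subset K by apply/andP; rewrite -finset.subsetI.
have /cards1P[x B0I] : #|B0 :\: I| == 1.
  by rewrite cardsDS // cI card_basis // -[X in X - _](prednK r_gt0) subSnn.
have B0E : B0 :\ x = I.
  rewrite -B0I; apply/setP => z; rewrite !inE negb_and negbK.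
  by case: (boolP (z \in I)) => [/(fintype.subsetP IB0)->|] //=; case: (z \in B0).
have xB0 : x \in B0 by have := set11 x; rewrite -B0I inE => /andP[].
have xHK : x \notin H :|: K.
  have yI : x |: I = B0 by rewrite -B0E finset.setD1K.
  apply/negP; rewrite inE => /orP[yH|yK].
    by have /negP[] := stressed_basis_free HS B0M;
      rewrite -yI finset.subUset finset.sub1set yH.
  by have /negP[] := stressed_basis_free KS B0M;
    rewrite -yI finset.subUset finset.sub1set yK.
have HKfree : basis_free (H :|: K).
  apply/forall_inP => B BM; apply/negP => BHK.
  have xB : x \notin B by apply: contra xHK; exact: fintype.subsetP.
  have [|y] := bases_exchange B0M BM (x := x); first by rewrite inE xB.
  rewrite B0E inE => /andP[_ /(fintype.subsetP BHK)];
    rewrite inE => /orP[yH|yK] yIM.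
    by have /negP[] := stressed_basis_free HS yIM;
      rewrite finset.subUset finset.sub1set yH.
  by have /negP[] := stressed_basis_free KS yIM;
    rewrite finset.subUset finset.sub1set yK.
move: HS KS; rewrite !inE => /andP[/maxsetP[_ maxH] _] /andP[/maxsetP[_ maxK] _].
by rewrite -(maxH _ HKfree (finset.subsetUl _ _)) (maxK _ HKfree
  (finset.subsetUr _ _)).
Qed.

(** A non-basis of size [mrank M] contains no basis, since all bases have that size, so it extends
    to a stressed set. *)
Lemma bases_stressed B : (B \in bases M) = sparse_basis (mrank M) stressed B.
Proof.
apply/idP/idP => [BM|/andP[/eqP cB /forall_inP Bfree]].
  rewrite /sparse_basis card_basis // eqxx; apply/forall_inP => H HS.
  exact: stressed_basis_free.
apply: contraT => BM; have free : basis_free B.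
  apply/forall_inP => A AM; apply: contra BM => AB.
  by have /eqP <- : A == B by rewrite eqEcard AB cB card_basis //=.
have [H Hmax BH] := maxset_exists free.
have /Bfree /negP[] // : H \in stressed.
by rewrite inE Hmax -cB subset_leq_card.
Qed.

Lemma card_stressedC H : H \in stressed -> 0 < #|~: H|.
Proof.
move=> HS; rewrite card_gt0; have /set0Pn[B BM] := bases_neq0 M.
apply: contraNneq (stressed_basis_free HS BM) => /(congr1 (@finset.setC _)).
by rewrite finset.setCK finset.setC0 => ->; exact: finset.subsetT.
Qed.
End StressedHyperplanes.

Local Open Scope ring_scope.

(** * Formal power series *)

Definition pser (A : Type) := nat -> A.

Section PowerSeries.
Variable A : comNzRingType.
Implicit Types f g h : pser A.

HB.instance Definition _ := gen_eqMixin (pser A).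
HB.instance Definition _ := gen_choiceMixin (pser A).

Definition ps_trunc (N : nat) f : {poly A} := \poly_(i < N) f i.

Definition ps_zero : pser A := fun=> 0.
Definition ps_add f g : pser A := fun n => f n + g n.
Definition ps_opp f : pser A := fun n => - f n.
Definition ps_const (a : A) : pser A := fun n => if n == 0%N then a else 0.
Definition ps_mul f g : pser A := fun n => \sum_(i < n.+1) f i * g (n - i)%N.

Lemma ps_addA : associative ps_add.
Proof. by move=> f g h; apply/funext => n; rewrite /ps_add addrA. Qed.
Lemma ps_addC : commutative ps_add.
Proof. by move=> f g; apply/funext => n; rewrite /ps_add addrC. Qed.
Lemma ps_add0 : left_id ps_zero ps_add.
Proof. by move=> f; apply/funext => n; rewrite /ps_add add0r. Qed.
Lemma ps_addN : left_inverse ps_zero ps_opp ps_add.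
Proof. by move=> f; apply/funext => n; rewrite /ps_add addNr. Qed.

HB.instance Definition _ :=
  GRing.isZmodule.Build (pser A) ps_addA ps_addC ps_add0 ps_addN.

(** Through truncations the ring laws and the Leibniz rule are inherited from polynomials. *)
Lemma ps_mul_trunc N f g n : (n < N)%N ->
  ps_mul f g n = (ps_trunc N f * ps_trunc N g)`_n.
Proof.
move=> ltnN; rewrite coefM /ps_mul; apply: eq_bigr => i _.
have ltiN : (i < N)%N := leq_trans (ltn_ord i) ltnN.
by rewrite !coef_poly ltiN (leq_ltn_trans (leq_subr i n) ltnN).
Qed.

Lemma ps_mulA : associative ps_mul.
Proof.
move=> f g h; apply/funext => n.
have tr (u w : pser A) i : (i < n.+1)%N ->
    (ps_trunc n.+1 (ps_mul u w))`_i = (ps_trunc n.+1 u * ps_trunc n.+1 w)`_i.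
  by move=> lti; rewrite coef_poly lti (ps_mul_trunc _ _ lti).
rewrite !(ps_mul_trunc _ _ (leqnn _)).
transitivity ((ps_trunc n.+1 f * (ps_trunc n.+1 g * ps_trunc n.+1 h))`_n).
  rewrite !(coefM (ps_trunc _ f)); apply: eq_bigr => i _.
  by rewrite tr // ltnS leq_subr.
rewrite mulrA !(coefMr _ (ps_trunc _ h)); apply: eq_bigr => i _.
by rewrite tr // ltnS leq_subr.
Qed.

Lemma ps_mulC : commutative ps_mul.
Proof.
by move=> f g; apply/funext => n; rewrite !(ps_mul_trunc _ _ (leqnn _)) mulrC.
Qed.

Lemma ps_mul1 : left_id (ps_const 1) ps_mul.
Proof.
move=> f; apply/funext => n; rewrite /ps_mul big_ord_recl /= mul1r subn0.
by rewrite big1 ?addr0 // => i _; rewrite mul0r.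
Qed.

Lemma ps_mulDl : left_distributive ps_mul ps_add.
Proof.
move=> f g h; apply/funext => n; rewrite /ps_mul /ps_add -big_split.
by apply: eq_bigr => i _; rewrite mulrDl.
Qed.

Lemma ps_one_neq0 : ps_const 1 != 0 :> pser A.
Proof. by apply/eqP => /(congr1 (@^~ 0%N)) /eqP; rewrite /= oner_eq0. Qed.

HB.instance Definition _ := GRing.Zmodule_isComNzRing.Build (pser A)
  ps_mulA ps_mulC ps_mul1 ps_mulDl ps_one_neq0.

Lemma psD f g n : (f + g) n = f n + g n. Proof. by []. Qed.
Lemma psN f n : (- f) n = - f n. Proof. by []. Qed.
Lemma psM f g n : (f * g) n = \sum_(i < n.+1) f i * g (n - i)%N.
Proof. by []. Qed.

Lemma ps1 n : (1 : pser A) n = (n == 0%N)%:R. Proof. by case: n. Qed.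
Lemma psMn f k n : (f *+ k) n = f n *+ k.
Proof. by elim: k => [|k IH] //; rewrite !mulrS psD IH. Qed.
Lemma ps_natM k f n : (k%:R * f) n = k%:R * f n.
Proof. by rewrite !mulr_natl psMn. Qed.

Lemma psM0 f g : (f * g) 0%N = f 0%N * g 0%N.
Proof. by rewrite psM big_ord_recl big_ord0 addr0. Qed.

Lemma ps_constM (a : A) f n : (ps_const a * f) n = a * f n.
Proof.
rewrite psM big_ord_recl /= subn0 big1 ?addr0 // => i _.
by rewrite /ps_const /= mul0r.
Qed.

Definition ps_var : pser A := fun n => (n == 1%N)%:R.

Lemma ps_varM0 f : (ps_var * f) 0%N = 0.
Proof. by rewrite psM0 mul0r. Qed.

Lemma ps_varMS f n : (ps_var * f) n.+1 = f n.
Proof.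
rewrite psM big_ord_recl mul0r add0r big_ord_recl /= mul1r subn1.
by rewrite big1 ?addr0 // => i _; rewrite /ps_var /= mul0r.
Qed.

Lemma ps_var_inj f g : ps_var * f = ps_var * g -> f = g.
Proof. by move=> fg; apply/funext => n; rewrite -(ps_varMS f) fg ps_varMS. Qed.

Definition ps_geom : pser A := fun=> 1.

Lemma ps_geomE : (1 - ps_var) * ps_geom = 1.
Proof.
apply/funext => -[|n]; rewrite mulrBl mul1r psD psN ps1 /ps_geom.
  by rewrite ps_varM0 subr0.
by rewrite ps_varMS subrr.
Qed.

Definition ps_deriv f : pser A := fun n => f n.+1 *+ n.+1.

Lemma ps_derivD f g : ps_deriv (f + g) = ps_deriv f + ps_deriv g.
Proof. by apply/funext => n; rewrite psD /ps_deriv psD mulrnDl. Qed.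

Lemma ps_derivN f : ps_deriv (- f) = - ps_deriv f.
Proof. by apply/funext => n; rewrite psN /ps_deriv psN mulNrn. Qed.

Lemma ps_deriv_const (a : A) : ps_deriv (ps_const a) = 0.
Proof. by apply/funext => n; rewrite /ps_deriv /ps_const /= mul0rn. Qed.

Lemma ps_deriv_var : ps_deriv ps_var = 1.
Proof. by apply/funext => -[|n]; rewrite /ps_deriv /ps_var ps1 //= mul0rn. Qed.

Lemma ps_derivM f g : ps_deriv (f * g) = ps_deriv f * g + f * ps_deriv g.
Proof.
have tr u i n :
  (i < n.+1)%N -> (ps_trunc n.+1 (ps_deriv u))`_i = (ps_trunc n.+2 u)^`()`_i.
  by move=> lti; rewrite coef_deriv !coef_poly lti ltnS lti.
apply/funext => n; rewrite psD.
transitivity (((ps_trunc n.+2 f * ps_trunc n.+2 g)^`())`_n).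
  by rewrite coef_deriv -ps_mul_trunc.
rewrite derivM coefD; congr (_ + _).
  rewrite coefM psM; apply: eq_bigr => i _.
  by rewrite -tr // !coef_poly ltn_ord ltnS ltnW // ltnS leq_subr.
rewrite coefMr psM; apply/esym; rewrite (reindex_inj rev_ord_inj) /=;
  apply: eq_bigr => i _.
rewrite subSS (subKn (ltn_ord i : (i <= n)%N)).
by rewrite -tr // !coef_poly ltn_ord ltnS ltnW // ltnS leq_subr.
Qed.

Lemma ps_derivX f k : ps_deriv (f ^+ k.+1) = k.+1%:R * f ^+ k * ps_deriv f.
Proof.
elim: k => [|k IH]; first by rewrite expr1 expr0 !mul1r.
by rewrite exprS ps_derivM IH exprS -[in RHS]natr1; ring.
Qed.

End PowerSeries.

(** The lowest coefficient of [c * (f - g)] is [c 0] times that of [f - g], so [c] cancels even when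
    it is not a unit. *)
Lemma ps_mul_inj (A : idomainType) (c f g : pser A) :
  c 0%N != 0 -> c * f = c * g -> f = g.
Proof.
move=> c0 /eqP; rewrite -subr_eq0 -mulrBr => /eqP cfg.
apply/eqP; rewrite -subr_eq0; apply/eqP; move: (f - g) cfg => h ch.
apply/funext => n; elim/ltn_ind: n => n IH.
have := congr1 (@^~ n) ch; rewrite psM big_ord_recl subn0 big1 => [|i _].
  by rewrite addr0 => /eqP; rewrite mulf_eq0 (negPf c0) => /eqP.
by rewrite IH ?mulr0 // lift0 ltn_subrL (leq_trans _ (ltn_ord i)).
Qed.

(** * Differential equations for the slice series *)

Section DiffEq.
Variables (A : idomainType) (a : A).
Local Notation x := (ps_const a).
Local Notation v := (ps_var A).
Local Notation G := (ps_geom A).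

Definition ps_q : pser A := (1 - x * v) * G.
Local Notation q := ps_q.

Lemma ps_varG : v * G = G - 1.
Proof.
have := ps_geomE A; move: G v => g w; rewrite mulrBl mul1r => <-; ring.
Qed.

Lemma ps_qB1 : q - 1 = v * (1 - x) * G.
Proof. by rewrite /ps_q -[X in _ - X](ps_geomE A); ring. Qed.

Lemma ps_deriv_geom : ps_deriv G = G ^+ 2.
Proof.
have := congr1 (@ps_deriv A) (ps_geomE A).
rewrite ps_derivM ps_derivD ps_derivN ps_deriv_var !(ps_deriv_const 1) =>
  /(congr1 ( *%R G)).
have := ps_varG; move: (ps_deriv G) => g'; move: G v => g w wg H.
have {H} : g * (1 - w) * g' = g ^+ 2 by apply/eqP;
  rewrite -subr_eq0 -[0](mulr0 g) -H; apply/eqP; ring.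
suff -> : g * (1 - w) = 1 by rewrite mul1r.
by rewrite mulrBr mulr1 [g * w]mulrC wg; ring.
Qed.

Lemma ps_deriv_q : ps_deriv q = (1 - x) * G ^+ 2.
Proof.
rewrite /ps_q ps_derivM ps_derivD ps_derivN ps_derivM ps_deriv_const ps_deriv_var.
rewrite !(ps_deriv_const 1) ps_deriv_geom.
have := ps_varG; move: G v x => g w y wg; ring: wg.
Qed.

Lemma ps_q0 : q 0%N = 1.
Proof. by rewrite /ps_q psM0 mulr1 psD psN psM0 mulr0 subr0. Qed.

(* Differentiate the defining equation of [E], then cancel [1 - x * q ^+ t]. *)
Lemma riccati t (E : pser A) : a != 1 -> (1 - x * q ^+ t) * E = 1 - x ->
  (1 - x * v) * ps_deriv E = t%:R * G * E * (E - 1 + x).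
Proof.
move=> a1 EE; apply: (@ps_mul_inj _ (1 - x * q ^+ t)).
  rewrite psD psN psM0; suff -> : (q ^+ t) 0%N = 1.
    by rewrite mulr1 subr_eq0 eq_sym.
  by elim: t {EE} => [|k IH] //; rewrite exprS psM0 IH ps_q0 mulr1.
case: t => [|t] in EE *.
  have -> : E = 1.
    apply: (@ps_mul_inj _ (1 - x)); first by rewrite psD psN subr_eq0 eq_sym.
    by rewrite mulr1 -{2}EE expr0 mulr1.
  by rewrite ps_deriv_const; ring.
have := congr1 (@ps_deriv A) EE.
rewrite ps_derivM !(ps_derivD, ps_derivN, ps_deriv_const) ps_derivM ps_deriv_const.
rewrite ps_derivX ps_deriv_q => H.
have qE : (1 - x * v) * G = q by [].
move: (ps_deriv E) EE H qE => E'; rewrite exprS; move: q => Q.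
move: G v x => g w y EE H qE.
transitivity ((1 - y * w) * ((1 - y * (Q * Q ^+ t)) * E')); first by ring.
have -> : (1 - y * (Q * Q ^+ t)) * E' = y * t.+1%:R * Q ^+ t * (1 - y) * g ^+ 2 * E.
  by apply/eqP; rewrite -subr_eq0; apply/eqP;
    rewrite -[RHS]oppr0 -[RHS]add0r -H; ring.
transitivity (t.+1%:R * g * E * ((1 - y * (Q * Q ^+ t)) * E - (1 - y) * (1 - y
  * (Q * Q ^+ t)))); last by ring.
by rewrite EE -qE; ring.
Qed.

(** The series [S] of the overview. *)
Definition ps_binq m t : pser A :=
  \sum_(k < t) 'C(k + m, m)%:R * q ^+ (t.-1 - k).

Lemma ps_binqS m t : ps_binq m t.+1 = q * ps_binq m t + 'C(t + m, m)%:R.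
Proof.
rewrite /ps_binq big_ord_recr /= subnn mulr1; congr (_ + _).
rewrite mulr_sumr; apply: eq_bigr => k _.
rewrite mulrCA -exprS; congr (_ * _ ^+ _).
by case: t k => [[]//|t] k /=; rewrite subSn // -ltnS.
Qed.

(** Induction along [ps_binqS], using [v (1 - x v) q' = q (q - 1)] and [(t + 1) C(t + 1 + m, m) = (t
    + m + 1) C(t + m, m)]. *)
Lemma ps_binq_deriv m t :
  v * (1 - x * v) * ps_deriv (ps_binq m t) =
  ((t%:R - 1) * (q - 1) - m.+1%:R) * ps_binq m t + (t * 'C(t + m, m))%:R.
Proof.
have dn k : ps_deriv (k%:R : pser A) = 0.
  elim: k => [|k IH]; first by apply/funext => n; rewrite /ps_deriv mul0rn.
  by rewrite -natr1 ps_derivD IH (ps_deriv_const 1) addr0.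
elim: t => [|t IH].
  by rewrite /ps_binq big_ord0 (dn 0%N); ring.
rewrite ps_binqS ps_derivD dn ps_derivM ps_deriv_q addr0.
have -> : (t.+1 * 'C(t.+1 + m, m) = (t + m.+1) * 'C(t + m, m))%N.
  by have := mul_bin_down (t.+1 + m) m; rewrite addnK addSnnS => <-; rewrite addnS.
transitivity (q * (v * (1 - x) * G) * ps_binq m t +
   q * (v * (1 - x * v) * ps_deriv (ps_binq m t))); first by rewrite /ps_q; ring.
rewrite IH -ps_qB1 !natrM natrD -[t.+1%:R]natr1; ring.
Qed.

(** The term [- t (q - 1) V] coming from [E'] cancels against [t (q - 1) V] coming from the
    derivative of [ps_binq m t]; the remaining [v q V - (q - 1) V] is [x v V], because
    [(1 - v) q = 1 - x v]. *)
Lemma slice_ode m t (E : pser A) (V := G * E * ps_binq m t) :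
  (1 - x * v) * ps_deriv E = t%:R * G * E * (E - 1 + x) ->
  v * (1 - x * v) * ps_deriv V + m.+1%:R * V =
  (t * 'C(t + m, m))%:R * (E * G) + t%:R * (v * (G * E * V)) + x * (v * V).
Proof.
move=> EE; rewrite /V !ps_derivM ps_deriv_geom.
have SS := ps_binq_deriv m t;
  move: (ps_binq m t) (ps_deriv (ps_binq m t)) SS => S S' SS.
transitivity (v * (1 - x * v) * G ^+ 2 * E * S
  + G * S * v * ((1 - x * v) * ps_deriv E)
  + G * E * (v * (1 - x * v) * S') + m.+1%:R * (G * E * S)); first by ring.
rewrite EE SS /ps_q; have := ps_varG; move: G v x => g w y wg.
ring: wg.
Qed.

(* The hypotheses on [Th] are those satisfied by [boxser t] below. *)
Variables (t : nat) (Th : nat -> pser A).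
Hypothesis ThS : forall j, (j < t)%N ->
  (1 - v) * Th j.+1 = (1 - x * v) * Th j - (j == 0%N)%:R.
Hypothesis Th_top : (0 < t)%N -> x * Th t = Th 0 - G.
Hypothesis Th_deg : t = 0%N -> (1 - x * v) * Th 0 = G.
Hypothesis Th00 : Th 0 0%N = 1.

(* [ps_red] is the solution [E] of [(1 - x * q ^+ t) * E = 1 - x] (see
   [ps_redE]); it is read off from [Th 0] because [1 - x * q ^+ t] has the
   constant term [1 - x], which is not invertible in [A = R[x]]. *)
Definition ps_red : pser A := (1 - v) * (fun s => ((1 - x * v) * Th 0) s.+1).
Local Notation E := ps_red.

Lemma ps_red0E : (1 - x * v) * Th 0 = 1 + v * G * E.
Proof.
set h := (X in X * Th 0).
have -> : v * G * E = v * (fun s => (h * Th 0) s.+1).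
  rewrite /E; move: (fun s => _) => f.
  transitivity ((1 - v) * G * (v * f)); first by ring.
  by rewrite ps_geomE mul1r.
apply/funext => -[|s]; rewrite psD ps1.
  by rewrite ps_varM0 addr0 psM0 /h psD psN psM0 mulr0 subr0 mul1r Th00.
by rewrite ps_varMS add0r.
Qed.

Lemma ps_red1E : (0 < t)%N -> Th 1 = v * G ^+ 2 * E.
Proof.
move=> t0; apply: (@ps_mul_inj _ (1 - v)); first by rewrite psD psN subr0 oner_eq0.
rewrite ThS // ps_red0E eqxx mulr1n.
have := ps_varG; move: E G v => e g w wg.
transitivity (w * g * (g - w * g) * e); last by ring.
by rewrite wg; ring.
Qed.

(** For [0 < j] the recursion [ThS] reads [Th j.+1 = q * Th j], as [G] inverts [1 - v]. *)
Lemma ps_redSE j : (j < t)%N -> Th j.+1 = q ^+ j * (v * G ^+ 2 * E).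
Proof.
elim: j => [|j IH] ltjt; first by rewrite mul1r ps_red1E.
apply: (@ps_mul_inj _ (1 - v)); first by rewrite psD psN subr0 oner_eq0.
rewrite ThS // subr0 IH 1?ltnW // (exprS q).
transitivity ((1 - x * v) * ((1 - v) * G) * (q ^+ j * (v * G ^+ 2 * E))).
  by rewrite ps_geomE; ring.
by move: (q ^+ j) => p; rewrite /ps_q; ring.
Qed.

(** [Th_top] closes the chain from [Th 0] to [Th t]: both ends are known in terms of [E], and their
    relation is the equation for [E]. For [t = 0], [Th_deg] gives [E = 1]. *)
Lemma ps_redE : (1 - x * q ^+ t) * E = 1 - x.
Proof.
have vg := ps_varG; have wg := ps_geomE A.
case: (posnP t) => [t0|t_gt0].
  have -> : E = 1.
    apply: ps_var_inj; apply: (@ps_mul_inj _ G); first exact: oner_neq0.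
    have := ps_red0E; rewrite Th_deg // => H.
    transitivity (v * G * E); first by ring.
    by rewrite -[LHS](addrK 1) [_ + 1]addrC -H -vg; ring.
  by rewrite t0 expr0 !mulr1.
apply: (@ps_mul_inj _ G); first exact: oner_neq0.
apply: ps_var_inj.
have := congr1 ( *%R (1 - x * v)) (Th_top t_gt0).
rewrite mulrBr ps_red0E -[in Th t](prednK t_gt0) ps_redSE ?prednK // => H.
have -> : q ^+ t = q * q ^+ t.-1 by rewrite -exprS prednK.
transitivity (v * G * E - (1 - x * v) * (x * (q ^+ t.-1 * (v * G ^+ 2 * E)))).
  by move: (q ^+ t.-1) => p; rewrite /ps_q; ring.
rewrite H; move: E G v x vg wg {H} => e g w y wg _.
ring: wg.
Qed.

Lemma ps_red0 : a != 1 -> E 0%N = 1.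
Proof.
move=> a1; have /(congr1 (@^~ 0%N)) := ps_redE.
rewrite psM0 !(psD, psN) psM0.
have -> : (q ^+ t) 0%N = 1.
  by elim: t => [|k IHk] //; rewrite exprS psM0 IHk ps_q0 mulr1.
rewrite mulr1 => H; apply: (@mulfI _ (1 - a)); first by rewrite subr_eq0 eq_sym.
by rewrite mulr1.
Qed.

Lemma ps_red_deriv : a != 1 ->
  (1 - x * v) * ps_deriv E = t%:R * G * E * (E - 1 + x).
Proof. by move=> a1; apply: (riccati a1); exact: ps_redE. Qed.

(** For [Th = boxser t] the left side generates the slice sizes: [k] is the coordinate sum outside
    the hyperplane, attained by [m.+1] coordinates in [C(k + m, m)] ways. *)
Lemma sum_bin_ser m :
  \sum_(k < t) 'C(k + m, m)%:R * Th (t - k) = v * G * (G * E * ps_binq m t).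
Proof.
transitivity (v * G ^+ 2 * E * ps_binq m t); last by ring.
rewrite mulr_sumr; apply: eq_bigr => k _.
have ltkt := ltn_ord k.
by rewrite (_ : t - k = (t.-1 - k).+1)%N ?ps_redSE; [ring | lia | lia].
Qed.
End DiffEq.

(** * Lattice points of boxes *)

Section Boxes.
Variables (R : idomainType).
Local Notation x := (ps_const ('X : {poly R})).
Local Notation v := (ps_var {poly R}).
Local Notation G := (ps_geom {poly R}).
Local Notation q := (ps_q ('X : {poly R})).

(** Generating polynomial of one coordinate; its [s]-th power counts the points of [{0..t}^s] by
    coordinate sum. *)
Definition boxpoly t : {poly R} := \poly_(j < t.+1) 1.

Lemma boxpolyE t : (1 - 'X) * boxpoly t = 1 - 'X^(t.+1).
Proof.
apply/polyP => i; rewrite mulrBl mul1r !coefB coefXM !coef_poly coef1 coefXn.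
case: i => [|i] /=; first by rewrite subr0.
rewrite !ltnS eqSS; case: ltngtP => //= _; rewrite ?subrr //.
Qed.

Lemma boxpoly_coefS t s k :
  (boxpoly t ^+ s.+1)`_k.+1 - (boxpoly t ^+ s.+1)`_k =
  (boxpoly t ^+ s)`_k.+1 - (if (k < t)%N then 0 else (boxpoly t ^+ s)`_(k - t)).
Proof.
have := congr1 (fun p : {poly R} => (p * boxpoly t ^+ s)`_k.+1) (boxpolyE t).
by rewrite -mulrA -exprS !mulrBl !mul1r !coefB coefXM coefXnM ltnS subSS.
Qed.

Lemma boxpoly_coef_hi t s k : (t * s < k)%N -> (boxpoly t ^+ s)`_k = 0.
Proof.
move=> ltk; rewrite nth_default // (leq_trans (size_poly_exp_leq _ _)) //.
apply: leq_ltn_trans ltk; rewrite leq_mul2r; apply/orP; right.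
by rewrite -subn1 leq_subLR add1n size_poly.
Qed.

Lemma boxpoly_coef0 t s : (boxpoly t ^+ s)`_0 = 1.
Proof.
rewrite -horner_coef0 horner_exp horner_coef0 /boxpoly coef_poly /=.
by rewrite expr1n.
Qed.

(** In degree at most [t] the upper bound on the coordinates is void, and [boxpoly_coefS] becomes
    Pascal's rule. *)
Lemma boxpoly_coef_lo t m k : (k <= t)%N ->
  (boxpoly t ^+ m.+1)`_k = 'C(k + m, m)%:R.
Proof.
elim: m k => [|m IHm] k; first by rewrite expr1 coef_poly ltnS bin0 => ->.
elim: k => [|k IHk] lekt; first by rewrite boxpoly_coef0 binn.
have /eqP := boxpoly_coefS t m.+1 k.
rewrite lekt subr0 subr_eq (IHm k.+1 lekt) (IHk (ltnW lekt)) -natrD => /eqP ->.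
by congr _%:R; rewrite [in RHS]addSn binS addSnnS addnC.
Qed.

(* For [t > 0] the coefficient of [v ^ s * X ^ r] counts the points of
   [{0..t}^s] with sum [t * r + j]; larger [r] contribute nothing. *)
Definition boxser t j : pser {poly R} :=
  fun s => \poly_(r < s.+1) (boxpoly t ^+ s)`_(t * r + j).

Lemma boxser_coef t j s r : (0 < t)%N ->
  (boxser t j s)`_r = (boxpoly t ^+ s)`_(t * r + j).
Proof.
move=> t0; rewrite coef_poly; case: ltnP => // lesr.
by rewrite boxpoly_coef_hi // (@leq_trans (t * r)) ?leq_addr // ltn_pmul2l.
Qed.

(** This is [boxpoly_coefS] at [k = t * r + j]: lowering the index by [t] lowers [r] by one, whence
    the factor [x], and [k < t] exactly when [r = 0]. The correction is the constant term of
    [boxser t 0]. *)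
Lemma boxserS t j : (j < t)%N ->
  (1 - v) * boxser t j.+1 = (1 - x * v) * boxser t j - (j == 0%N)%:R.
Proof.
move=> ltjt; have t0 : (0 < t)%N by apply: leq_ltn_trans ltjt.
rewrite !mulrBl !mul1r -mulrA; apply/funext => -[|s]; rewrite !(psD, psN).
  rewrite ps_constM !ps_varM0 mulr0 !subr0.
  apply/polyP => r; rewrite coefB !boxser_coef // !expr0 !coef1 addnS /=.
  case: j ltjt => [|j] _ /=; last by rewrite addnS coef0 subrr.
  by rewrite addn0 coef1 muln_eq0 gtn_eqF //= subrr.
rewrite ps_constM !ps_varMS.
have -> : ((j == 0%N)%:R : pser {poly R}) s.+1 = 0 by case: j {ltjt}.
rewrite subr0; apply/polyP => r; rewrite !coefB coefXM !boxser_coef //.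
rewrite addnS; have := boxpoly_coefS t s (t * r + j).
case: r => [|r] /=.
  by rewrite muln0 add0n ltjt => /eqP; rewrite subr_eq => /eqP ->; ring.
have -> : (t * r.+1 + j - t = t * r + j)%N by rewrite mulnS -addnA addKn.
rewrite ltnNge mulnS -addnA leq_addr /= => /eqP.
by rewrite subr_eq => /eqP ->; ring.
Qed.

(** Since [t * r + t = t * r.+1], a factor [X] turns offset [t] into offset [0]; only the
    coefficients at [r = 0] are missed, and they form [G]. *)
Lemma boxser_top t : (0 < t)%N -> x * boxser t t = boxser t 0 - G.
Proof.
move=> t0; apply/funext => s; rewrite ps_constM psD psN /ps_geom.
apply/polyP => r; rewrite coefXM coefB !boxser_coef // coef1.
case: r => [|r] /=; first by rewrite muln0 boxpoly_coef0 subrr.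
by rewrite subr0 addn0 mulnSr.
Qed.

Lemma boxser00 t : boxser t 0 0%N = 1.
Proof.
apply/polyP => r; rewrite coef_poly expr0 !coef1; case: r => //=.
by rewrite muln0.
Qed.

(** At [t = 0] every coefficient kept by the truncation is 1, which makes the series
    [1 / ((1 - v) (1 - X v))]. *)
Lemma boxser_deg t : t = 0%N -> (1 - x * v) * boxser t 0 = G.
Proof.
move=> ->; rewrite mulrBl mul1r -mulrA; apply/funext => -[|s];
  rewrite psD psN ps_constM.
  by rewrite ps_varM0 mulr0 subr0 boxser00.
rewrite ps_varMS; apply/polyP => r; rewrite coefB coefXM !coef_poly coef1.
rewrite !mul0n boxpoly_coef0.
case: r => [|r] /=; first by rewrite subr0.
by rewrite addn0 boxpoly_coef0 ltnS subrr.
Qed.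
End Boxes.

(** * Nonnegativity of coefficients *)

Section NonnegFamilies.
Variable R : numFieldType.
Implicit Types phi psi : nat -> {poly R}.

(* [P] has the variables [X] (outer) and [t] (inner). *)
Definition nnpoly phi := exists2 P : {poly {poly R}},
  (forall i j, 0 <= P`_i`_j)
  & forall t, phi t = map_poly (horner_eval t%:R) P.

Lemma nnpolyD phi psi :
  nnpoly phi -> nnpoly psi -> nnpoly (fun t => phi t + psi t).
Proof.
move=> [P P0 PE] [Q Q0 QE]; exists (P + Q).
  by move=> i j; rewrite !coefD addr_ge0.
by move=> t; rewrite PE QE rmorphD.
Qed.

Lemma nnpolyM phi psi :
  nnpoly phi -> nnpoly psi -> nnpoly (fun t => phi t * psi t).
Proof.
move=> [P P0 PE] [Q Q0 QE]; exists (P * Q).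
  move=> i j; rewrite coefM coef_sum; apply: sumr_ge0 => k _.
  by rewrite coefM; apply: sumr_ge0 => l _; exact: mulr_ge0.
by move=> t; rewrite PE QE rmorphM.
Qed.

Lemma nnpolyX : nnpoly (fun=> 'X).
Proof.
exists 'X; first by move=> i j; rewrite coefX; case: eqP;
  rewrite ?coef0 ?coef1 ?ler0n.
by move=> t; rewrite map_polyX.
Qed.

Lemma nnpolyC (c : R) : 0 <= c -> nnpoly (fun=> c%:P).
Proof.
move=> c0; exists (c%:P%:P); first by move=> i j; rewrite coefC; case: eqP;
  rewrite ?coef0 // coefC; case: eqP.
by move=> t; rewrite map_polyC /= horner_evalE hornerC.
Qed.

Lemma nnpoly_nat k : nnpoly (fun=> k%:R).
Proof.
rewrite (_ : (fun=> k%:R) = (fun=> (k%:R)%:P)); first exact: nnpolyC.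
by apply/funext => t; rewrite polyC_natr.
Qed.

Lemma nnpoly_param : nnpoly (fun t => t%:R).
Proof.
exists ('X%:P); first by move=> i j; rewrite coefC; case: eqP;
  rewrite ?coef0 // coefX ler0n.
by move=> t; rewrite map_polyC /= horner_evalE hornerX polyC_natr.
Qed.

Lemma nnpoly_sum n (phi : nat -> nat -> {poly R}) :
  (forall i, (i < n)%N -> nnpoly (phi i)) ->
  nnpoly (fun t => \sum_(i < n) phi i t).
Proof.
elim: n => [|n IH] phiP.
  rewrite (_ : (fun=> _) = (fun=> 0%:R)); first exact: nnpoly_nat.
  by apply/funext => t; rewrite big_ord0.
under eq_fun do rewrite big_ord_recr.
by apply: nnpolyD; [apply: IH => i /ltnW; exact: phiP | exact: phiP].
Qed.

Lemma nnpoly_div k phi : nnpoly (fun t => k.+1%:R * phi t) -> nnpoly phi.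
Proof.
move=> phiP; rewrite (_ : phi = fun t => (k.+1%:R^-1)%:P * (k.+1%:R * phi t)).
  by apply: nnpolyM => //; apply: nnpolyC; rewrite invr_ge0.
by apply/funext => t; rewrite mulrA -polyC_natr -polyCM mulVf ?mul1r ?pnatr_eq0.
Qed.

(** The value is [t (t + 1) ... (t + m) / m!], a product of factors with nonnegative
    coefficients. *)
Lemma nnpoly_bin m : nnpoly (fun t => (t * 'C(t + m, m))%:R).
Proof.
elim: m => [|m IH].
  by under eq_fun do rewrite bin0 muln1; exact: nnpoly_param.
apply: (@nnpoly_div m).
rewrite (_ : (fun t => _) = fun t : nat =>
   (t%:R + m.+1%:R) * (t * 'C(t + m, m))%:R :> {poly R}).
  by apply: nnpolyM => //; apply: nnpolyD (nnpoly_nat _); exact: nnpoly_param.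
apply/funext => t; rewrite -natrD -!natrM; congr _%:R.
by rewrite mulnCA -mul_bin_diag addnS /= [RHS]mulnCA.
Qed.

(** The bound [n] makes products available inside inductions on the coefficient index. *)
Definition nnpser n (f : nat -> pser {poly R}) :=
  forall s, (s <= n)%N -> nnpoly (fun t => f t s).

Lemma nnpserM n f g : nnpser n f -> nnpser n g ->
  nnpser n (fun t => f t * g t).
Proof.
move=> fP gP s lesn; under eq_fun do rewrite psM.
apply: (@nnpoly_sum _ (fun i t => f t i * g t (s - i)%N)) => i ltis.
apply: nnpolyM; first by apply: fP; rewrite (leq_trans _ lesn).
by apply: gP; rewrite (leq_trans (leq_subr _ _)).
Qed.

Lemma nnpser_geom n : nnpser n (fun=> ps_geom {poly R}).
Proof. by move=> s _; exact: (nnpoly_nat 1). Qed.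

Local Notation x := (ps_const ('X : {poly R})).
Local Notation v := (ps_var {poly R}).
Local Notation G := (ps_geom {poly R}).
Local Notation E := (fun t => ps_red ('X : {poly R}) (boxser R t)).

Lemma polyX_neq1 : 'X != 1 :> {poly R}.
Proof. by rewrite -subr_eq0 -polyC1 polyXsubC_eq0. Qed.

Lemma boxser_red0 t : E t 0%N = 1.
Proof.
apply: (ps_red0 (t := t)); [exact: boxserS|exact: boxser_top|exact: boxser_deg| |].
  exact: boxser00.
exact: polyX_neq1.
Qed.

Lemma boxser_red_deriv t :
  (1 - x * v) * ps_deriv (E t) = t%:R * G * E t * (E t - 1 + x).
Proof.
apply: (ps_red_deriv (t := t));
  [exact: boxserS|exact: boxser_top|exact: boxser_deg| |].
  exact: boxser00.
exact: polyX_neq1.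
Qed.

Lemma boxser_redS t s : s.+1%:R * E t s.+1 =
  'X * (s%:R * E t s) + t%:R * (G * E t * (E t - 1 + x)) s.
Proof.
have := congr1 (@^~ s) (boxser_red_deriv t).
rewrite -!mulrA ps_natM mulrBl mul1r psD psN -mulrA ps_constM.
rewrite {1}/ps_deriv => /eqP; rewrite subr_eq addrC => /eqP H; rewrite mulr_natl H.
congr (_ * _ + _).
by case: s {H} => [|s]; rewrite ?ps_varM0 ?mul0r // ps_varMS mulr_natl.
Qed.

Lemma nnpser_red n : nnpser n E.
Proof.
elim: n => [|n IH] s; rewrite leq_eqVlt => /orP[/eqP ->|]; rewrite ?ltnS //.
- by under eq_fun do rewrite boxser_red0; exact: (nnpoly_nat 1).
- apply: (@nnpoly_div n); under eq_fun do rewrite boxser_redS.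
  apply: nnpolyD; apply: nnpolyM => //; [exact: nnpolyX| |exact: nnpoly_param|].
    by apply: nnpolyM (IH _ _); first exact: nnpoly_nat.
  have := leqnn n; apply: nnpserM; first exact: nnpserM (@nnpser_geom n) IH.
  (* The constant term of [E - 1 + x] is [X] and its other coefficients are those of [E], so the
     subtraction disappears. *)
  case=> [|k] lekn.
    under eq_fun do rewrite !(psD, psN) boxser_red0 subrr add0r.
    exact: nnpolyX.
  under eq_fun do rewrite !(psD, psN) subr0 addr0.
  exact: IH.
exact: IH.
Qed.

(** The series [V] of the overview. *)
Definition sliceser m t : pser {poly R} := G * E t * ps_binq 'X m t.

(** Coefficient of [v ^ s] in [slice_ode]; the negative term of [v (1 - X v) V'] joins [X v V] on
    the right, leaving only lower coefficients of [V] there. *)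
Lemma sliceser_rec m t s : (s + m.+1)%:R * sliceser m t s =
  (t * 'C(t + m, m))%:R * (E t * G) s
  + (if s is s'.+1 then t%:R * (G * E t * sliceser m t) s'
      + 'X * (s%:R * sliceser m t s') else 0).
Proof.
have := congr1 (@^~ s) (slice_ode m (boxser_red_deriv t)).
rewrite -/(sliceser m t) -!mulrA !psD !ps_natM ps_constM.
case: s => [|s].
  by rewrite !ps_varM0 !mulr0 !addr0 add0r.
rewrite !ps_varMS mulrBl mul1r psD psN -!mulrA ps_constM.
have -> : (v * ps_deriv (sliceser m t)) s = s%:R * sliceser m t s.
  by case: s => [|s]; rewrite ?ps_varM0 ?mul0r // ps_varMS mulr_natl.
rewrite {1}/ps_deriv => /eqP; rewrite addrAC subr_eq => /eqP H.
by rewrite natrD mulrDl mulr_natl H -natr1; ring.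
Qed.

Lemma nnpser_slice m n : nnpser n (sliceser m).
Proof.
elim: n => [|n IH] s; rewrite leq_eqVlt => /orP[/eqP ->|]; rewrite ?ltnS //.
- apply: (@nnpoly_div m); rewrite -[m.+1]add0n.
  under eq_fun do rewrite sliceser_rec addr0.
  apply: nnpolyM; first exact: nnpoly_bin.
  exact: (nnpserM (@nnpser_red 0) (@nnpser_geom 0)).
- apply: (@nnpoly_div (n.+1 + m)); rewrite -addnS.
  under eq_fun do rewrite sliceser_rec.
  apply: nnpolyD.
    apply: nnpolyM; first exact: nnpoly_bin.
    exact: (nnpserM (@nnpser_red n.+1) (@nnpser_geom n.+1)).
  apply: nnpolyD; apply: nnpolyM; [exact: nnpoly_param| |exact: nnpolyX|].
    exact: (nnpserM (nnpserM (@nnpser_geom n) (@nnpser_red n)) IH (leqnn n)).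
  by apply: nnpolyM; [exact: nnpoly_nat|exact: IH].
exact: IH.
Qed.

Lemma nnpoly_coef phi r : nnpoly phi ->
  exists2 p : {poly R}, (forall d, 0 <= p`_d) & forall t, p.[t%:R] = (phi t)`_r.
Proof.
move=> [P P0 PE]; exists P`_r => // t.
by rewrite PE coef_map.
Qed.

(** By [card_box_slice] the sum is the size of a slice for rank [r.+1], with [s] elements in the
    hyperplane and [m.+1] outside. *)
Lemma slice_poly m s r : exists2 p : {poly R}, (forall d, 0 <= p`_d) &
  forall t, p.[t%:R] = \sum_(k < t)
    (boxpoly R t ^+ m.+1)`_k * (boxpoly R t ^+ s)`_(t * r + (t - k)).
Proof.
have [p p0 pE] : exists2 p : {poly R}, (forall d, 0 <= p`_d) &
    forall t, p.[t%:R] = ((v * (G * sliceser m t)) s)`_r.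
  apply: nnpoly_coef; case: s => [|s].
    by under eq_fun do rewrite ps_varM0; exact: (nnpoly_nat 0).
  under eq_fun do rewrite ps_varMS.
  exact: (nnpserM (@nnpser_geom s) (@nnpser_slice m s) (leqnn s)).
exists p => // t; rewrite pE.
have H := sum_bin_ser (@boxserS R t) (@boxser_top R t) (@boxser_deg R t)
  (boxser00 R t) m.
rewrite mulrA -[_ * sliceser m t]H.
have psum (F : 'I_t -> pser {poly R}) : (\sum_k F k) s = \sum_k F k s.
  by elim/big_rec2: _ => // k a b _ <-.
rewrite psum coef_sum; apply: eq_bigr => k _.
have ltkt := ltn_ord k.
rewrite ps_natM -polyC_natr coefCM boxser_coef ?(leq_trans _ ltkt) //.
by rewrite boxpoly_coef_lo // ltnW.
Qed.

(** The coefficients of [boxser R t 0] follow a recursion without subtraction, read off from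
    [ps_red0E]. *)
Lemma hypersimplex_poly n r : (r <= n)%N ->
  exists p : {poly R}, forall t, p.[t%:R] = (boxpoly R t ^+ n)`_(t * r).
Proof.
move=> lern; have [p _ pE] : exists2 p : {poly R}, (forall d, 0 <= p`_d) &
    forall t, p.[t%:R] = (boxser R t 0 n)`_r.
  apply: nnpoly_coef; elim: n {lern} => [|n IH].
    by under eq_fun do rewrite boxser00; exact: (nnpoly_nat 1).
  have rec t : boxser R t 0 n.+1 = 'X * boxser R t 0 n + (G * E t) n.
    have := congr1 (@^~ n.+1) (@ps_red0E _ 'X (boxser R t) (boxser00 R t)).
    rewrite mulrBl mul1r psD psN -!mulrA ps_constM ps_varMS psD ps_varMS add0r.
    by move/eqP; rewrite subr_eq addrC => /eqP.
  under eq_fun do rewrite rec.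
  apply: nnpolyD; first exact: nnpolyM nnpolyX IH.
  exact: (nnpserM (@nnpser_geom n) (@nnpser_red n) (leqnn n)).
by exists p => t; rewrite pE coef_poly ltnS lern addn0.
Qed.
End NonnegFamilies.

(** * Counting box points by coordinate sums *)

Section Counting.
Variables (R : numFieldType) (n t : nat).
Implicit Types (H : {set 'I_n}) (f : {ffun 'I_n -> 'I_t.+1}).

(** Expanding a product over the coordinates gives one monomial per point, the outer variable
    marking coordinates in [H] and the inner one the others. *)
Lemma card_box_split H a b :
  #|[set f : {ffun 'I_n -> 'I_t.+1} |
      (\sum_(i in H) f i == a)%N & (\sum_(i in ~: H) f i == b)%N]|%:R
  = (boxpoly R t ^+ #|H|)`_a * (boxpoly R t ^+ #|~: H|)`_b.
Proof.
pose F (i : 'I_n) (j : 'I_t.+1) : {poly {poly R}} :=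
  if i \in H then 'X^j else ('X^j)%:P.
have Fsum i : \sum_j F i j =
    if i \in H then map_poly polyC (boxpoly R t) else (boxpoly R t)%:P.
  rewrite /F; case: ifP => _; rewrite /boxpoly poly_def rmorph_sum;
    apply: eq_bigr => j _;
    by rewrite scale1r // rmorphXn /= map_polyX.
have Fprod f : \prod_i F i (f i) =
    'X^(\sum_(i in H) f i) * ('X^(\sum_(i in ~: H) f i))%:P.
  rewrite (bigID (mem H)) /= -!prodrXr rmorph_prod /=; congr (_ * _).
    by apply: eq_bigr => i iH; rewrite /F iH.
  by apply: eq_big => [i|i /negPf iH]; rewrite ?inE // /F iH.
have : \prod_i \sum_j F i j = \sum_(f : {ffun 'I_n -> 'I_t.+1}) \prod_i F i (f i).
  exact: bigA_distr_bigA.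
rewrite (eq_bigr _ (fun i _ => Fsum i)) [RHS](eq_bigr _ (fun f _ => Fprod f)).
rewrite (bigID (mem H)) /=.
rewrite (eq_bigr (fun=> map_poly polyC (boxpoly R t))); last by move=> i ->.
rewrite prodr_const (eq_bigr (fun=> (boxpoly R t)%:P)); last by move=> i /negPf ->.
rewrite (eq_bigl (mem (~: H))); last by move=> i; rewrite !inE.
rewrite prodr_const -!rmorphXn /= => /(congr1 (fun p : {poly {poly R}} => p`_a`_b)).
rewrite coefMC coef_map /= coefCM => ->.
rewrite !coef_sum -sum1_card natr_sum big_mkcond /=; apply: eq_bigr => f _.
rewrite coefMC coefXn inE [a == _]eq_sym; case: eqP => _ /=;
  last by rewrite mul0r coef0.
by rewrite mul1r coefXn eq_sym; case: eqP.
Qed.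

Lemma card_box k :
  #|[set f : {ffun 'I_n -> 'I_t.+1} | (\sum_i f i == k)%N]|%:R
  = (boxpoly R t ^+ n)`_k.
Proof.
have := card_box_split finset.setT k 0.
rewrite finset.setCT cards0 expr0 coef1 mulr1 cardsT card_ord => <-; congr (_%:R).
apply: eq_card => f; rewrite !inE big_set0 eqxx andbT; congr (_ == _).
by apply: eq_bigl => i; rewrite inE.
Qed.

(** Points are sorted by their sum [k] outside [H]: the sum inside is [t * r.+1 - k], and the slice
    inequality says [k < t]. *)
Lemma card_box_slice H r :
  #|[set f : {ffun 'I_n -> 'I_t.+1} |
      (\sum_i f i == t * r.+1)%N & (t * r.+1 < \sum_(i in H) f i + t)%N]|%:R
  = \sum_(k < t) (boxpoly R t ^+ #|~:
    H|)`_k * (boxpoly R t ^+ #|H|)`_(t * r + (t - k)).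
Proof.
under eq_bigr do rewrite mulrC -card_box_split -sum1_card.
rewrite -natr_sum -sum1_card; congr _%:R.
under [RHS]eq_bigr do rewrite big_mkcond /=.
rewrite exchange_big big_mkcond /=; apply: eq_bigr => f _.
have sumE : (\sum_i f i = \sum_(i in H) f i + \sum_(i in ~: H) f i)%N.
  rewrite (bigID (mem H)) /=; congr (_ + _)%N.
  by apply: eq_bigl => i; rewrite inE.
rewrite inE sumE; set a := (\sum_(i in H) _)%N; set b := (\sum_(i in ~: H) _)%N.
under eq_bigr do rewrite inE -/a -/b.
case: (ltnP b t) => [ltbt|lebt].
  rewrite (bigD1 (Ordinal ltbt)) //= eqxx andbT big1 ?addn0 => [|k].
    by congr (if _ then _ else _); apply/idP/idP; [case/andP|]; nia.
  rewrite -val_eqE /= => /negPf; rewrite eq_sym => ->; by rewrite andbF.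
rewrite big1; first by case: ifP => // /andP[]; nia.
move=> k _; case: ifP => // /andP[_ /eqP bk]; have := ltn_ord k; lia.
Qed.
End Counting.

(** * Lattice points of base polytopes *)

Section Hulls.
Local Open Scope classical_set_scope.
Variables (R : realType) (n : nat).
Implicit Types (A : set 'rV[R]_n) (x : 'rV[R]_n).

Lemma hull_le A (F : {linear 'rV[R]_n -> R^o}) (c : R) :
  (forall x, A x -> F x <= c) -> forall x, convex_hull A x -> F x <= c.
Proof.
move=> Ac x; apply: (@smallest_sub _ _ A [set x | F x <= c]) => //.
move=> y z l; rewrite !inE /= => yc zc.
rewrite linearD !linearZ /=.
have l0 : 0 <= l%:num by [].
have l1 : l%:num <= 1 by [].
rewrite -[leRHS](subrK (l%:num * c)) addrC.
have -> : c - l%:num * c = (1 - l%:num) * c by rewrite mulrBl mul1r.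
by apply: lerD; apply: ler_wpM2l; rewrite // subr_ge0.
Qed.

(** Convexity concerns two points, so the last point is added with weight [1 / (t + 2)] to the
    average of the others. *)
Lemma hull_average A t (x : nat -> 'rV[R]_n) :
  (forall l, (l < t.+1)%N -> A (x l)) ->
  convex_hull A (t.+1%:R^-1 *: \sum_(l < t.+1) x l).
Proof.
move=> Ax C [Cconv AC]; elim: t Ax => [|t IH] Ax.
  by rewrite big_ord1 invr1 scale1r; apply/AC/Ax.
have p0 : 0 <= (t.+2%:R^-1 : R) by rewrite invr_ge0.
have p1 : (t.+2%:R^-1 : R) <= 1 by rewrite invf_le1 ?ler1n ?ltr0n.
have := Cconv (x t.+1) (t.+1%:R^-1 *: \sum_(l < t.+1) x l) (Itv01 p0 p1).
rewrite !inE => /(_ (AC _ (Ax _ (ltnSn _)))).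
have /IH Cx : forall l, (l < t.+1)%N -> A (x l) by move=> l /ltnW; exact: Ax.
move=> /(_ Cx); set S := \sum_(l < t.+1) x l => CS.
suff <- : t.+2%:R^-1 *: x t.+1 + (1 - t.+2%:R^-1) *: (t.+1%:R^-1 *: S) =
    t.+2%:R^-1 *: \sum_(l < t.+2) x l by exact: CS.
rewrite big_ord_recr /= -/S scalerDr [RHS]addrC; congr (_ + _).
rewrite scalerA; congr (_ *: _).
have t1 : t.+1%:R != 0 :> R by rewrite pnatr_eq0.
have t2 : t.+2%:R != 0 :> R by rewrite pnatr_eq0.
apply: (mulIf t1); rewrite mulfVK //; apply: (mulfI t2).
rewrite mulrBr mulr1 divff // mulrA divff // mul1r -[t.+2%:R]natr1 addrK.
by [].
Qed.
End Hulls.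

Section LatticePoints.
Local Open Scope classical_set_scope.
Local Open Scope card_scope.
Variables (R : realType) (n : nat) (M : matroid n).
Implicit Types (x : 'rV[R]_n) (J : {set 'I_n}).

(** Valued in [R^o] to be a linear form to which [hull_le] applies. *)
Definition rowsum J x : R^o := \sum_(i in J) x 0 i.

Lemma rowsum_linear J : linear (rowsum J).
Proof.
move=> a x y; rewrite /rowsum scaler_sumr -big_split; apply: eq_bigr => i _.
by rewrite !mxE.
Qed.
HB.instance Definition _ J :=
  GRing.isLinear.Build R 'rV[R]_n R^o _ (rowsum J) (rowsum_linear J).

Lemma rowsum_indicator J B : rowsum J (indicator R B) = #|B :&: J|%:R.
Proof.
rewrite /rowsum -sum1_card natr_sum big_mkcond [RHS]big_mkcond.
apply: eq_bigr => i _; rewrite mxE inE andbC.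
by case: (i \in J); case: (i \in B).
Qed.

Lemma polytope_le J c : (forall B, B \in bases M -> #|B :&: J| <= c)%N ->
  forall x, @base_polytope R n M x -> rowsum J x <= c%:R.
Proof.
move=> Jc x; apply: (@hull_le _ _ _ (rowsum J)) => _ [B /= BM <-].
by rewrite rowsum_indicator ler_nat Jc.
Qed.

Lemma polytope_ge J c : (forall B, B \in bases M -> c <= #|B :&: J|)%N ->
  forall x, @base_polytope R n M x -> c%:R <= rowsum J x.
Proof.
move=> Jc x xP; rewrite -lerN2.
have -> : - rowsum J x = ( \- (rowsum J : {linear _ -> _})) x by [].
move: x xP; apply: hull_le => _ [B /= BM <-].
by rewrite rowsum_indicator lerN2 ler_nat Jc.
Qed.

Variables (r : nat) (HH : {set {set 'I_n}}).
Hypothesis HHsep : forall H K, H \in HH -> K \in HH -> H != K ->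
  (#|H :&: K|.+1 < r)%N.
Hypothesis basesE : forall B, (B \in bases M) = sparse_basis r HH B.

Definition lattice_box t : {set {ffun 'I_n -> 'I_t.+1}} :=
  finset (fun f : {ffun 'I_n -> 'I_t.+1} => (\sum_i f i == t * r)%N &&
    [forall H in HH, \sum_(i in H) f i + t <= t * r]%N).

Definition row_of_ffun t (f : {ffun 'I_n -> 'I_t.+1}) : 'rV[R]_n :=
  \row_i (f i)%:R.

Lemma row_of_ffun_inj t : injective (@row_of_ffun t).
Proof.
move=> f g /rowP fg; apply/ffunP => i; apply/val_inj/eqP.
by have := fg i; rewrite !mxE => /eqP; rewrite eqr_nat.
Qed.

(** One inclusion checks the linear inequalities at the bases; the other splits a point into [t]
    bases by [basis_decomposition] and averages their indicators. *)
Lemma lattice_pointsE t : lattice_points (@base_polytope R n M) t =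
  @row_of_ffun t @` [set` lattice_box t].
Proof.
have [B0 B0M] := finset.set0Pn _ (bases_neq0 M).
have cB B : B \in bases M -> #|B| = r by rewrite basesE => /andP[/eqP].
apply/seteqP; split => [_ [[x xP <-] /mxOverP yint]|_ [f /= fbox <-]].
  have x0 i : 0 <= x 0 i.
    by have := @polytope_ge [set i]%SET 0 (fun _ _ => leq0n _) x xP;
      rewrite /rowsum big_set1.
  have x1 i : x 0 i <= 1.
    have := @polytope_le [set i]%SET 1 _ x xP; rewrite /rowsum big_set1; apply.
    by move=> B _;
      rewrite -[X in (_ <= X)%N](cards1 i) subset_leq_card ?finset.subsetIr.
  have yE i : t%:R * x 0 i = (Num.truncn (t%:R * x 0 i))%:R.
    have := yint 0 i; rewrite mxE => yi; rewrite truncnK // natrEint yi.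
    by rewrite mulr_ge0.
  have ltt i : (Num.truncn (t%:R * x 0 i)%R < t.+1)%N.
    by rewrite ltnS -(ler_nat R) -yE ler_piMr.
  pose f := [ffun i => Ordinal (ltt i)].
  have fE J : (\sum_(i in J) f i)%:R = t%:R * rowsum J x :> R.
    rewrite natr_sum mulr_sumr; apply: eq_bigr => i _.
    by rewrite ffunE /= -yE.
  exists f; last by apply/rowP => i; rewrite !mxE ffunE /= -yE.
  rewrite /= inE; apply/andP; split.
    have -> : (\sum_i f i = \sum_(i in finset.setT) f i)%N.
      by apply: eq_bigl => i; rewrite inE.
    rewrite -(eqr_nat R) fE natrM; apply/eqP; congr (_ * _).
    apply/eqP; rewrite eq_le polytope_le ?polytope_ge //.
      by move=> B BM; rewrite finset.setIT cB.
    by move=> B BM; rewrite finset.setIT cB.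
  apply/forall_inP => H HHH.
  have HB B : B \in bases M -> (#|B :&: H| < r)%N.
    move=> BM; rewrite -(cB B BM); apply: proper_card;
      rewrite properE finset.subsetIl.
    rewrite finset.subsetI subxx /=; move: BM;
      rewrite basesE => /andP[_ /forall_inP]; exact.
  have r0 : (0 < r)%N by apply: leq_ltn_trans (HB _ B0M).
  rewrite -[in leqRHS](prednK r0) mulnS [leqRHS]addnC leq_add2r -(ler_nat R) fE
    natrM.
  rewrite ler_wpM2l // polytope_le // => B BM.
  by rewrite -ltnS prednK // HB.
move: fbox; rewrite inE => /andP[/eqP sumf /forall_inP Hf]; split; last first.
  by apply/mxOverP => i j; rewrite mxE; apply: intr_nat; exact: natr_nat.
have lef i : (f i <= t)%N by rewrite -ltnS.
have [B BM fB] := basis_decomposition HHsep lef sumf Hf.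
(* For [t = 0] the only point is 0, obtained from any basis; an average needs [t > 0]. *)
case: t f lef sumf Hf fB BM => [|t] f _ sumf Hf fB BM.
  exists (indicator R B0); first by apply: sub_gen_smallest; exists B0.
  by rewrite scale0r; apply/rowP => i; rewrite !mxE fB big_ord0.
exists (t.+1%:R^-1 *: \sum_(l < t.+1) indicator R (B l)).
  apply: (@hull_average _ _ _ _ (fun l => indicator R (B l))) => l ltl.
  by exists (B l) => //=; rewrite basesE BM.
rewrite scalerA divff ?pnatr_eq0 // scale1r.
apply/rowP => i; rewrite summxE mxE fB natr_sum; apply: eq_bigr => l _.
by rewrite mxE.
Qed.

Lemma card_lattice_points t :
  lattice_points (@base_polytope R n M) t #= `I_#|lattice_box t|.
Proof.
rewrite lattice_pointsE; apply: card_eq_trans.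
  by apply: inj_card_eq => f g _ _; exact: row_of_ffun_inj.
pose e k := nth [ffun=> ord0] (enum (lattice_box t)) k.
have -> : [set` lattice_box t] = e @` `I_#|lattice_box t|.
  apply/seteqP; split => [f /= fb|_ [k /= ltk <-]].
    exists (index f (enum (lattice_box t))); last by rewrite /e nth_index ?mem_enum.
    by rewrite /= cardE index_mem mem_enum.
  by rewrite /= -mem_enum mem_nth // -cardE.
apply: inj_card_eq => k l; rewrite !inE /= cardE => ltk ltl /eqP.
by rewrite nth_uniq ?enum_uniq // => /eqP.
Qed.
End LatticePoints.

(** * Slices cut off from the hypersimplex *)

Section Slices.
Variables (n r : nat) (HH : {set {set 'I_n}}).
Hypothesis HHsep : forall H K, H \in HH -> K \in HH -> H != K ->
  (#|H :&: K|.+1 < r)%N.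

Definition box_slice t (H : {set 'I_n}) : {set {ffun 'I_n -> 'I_t.+1}} :=
  finset (fun f : {ffun 'I_n -> 'I_t.+1} => (\sum_i f i == t * r)%N &&
    (t * r < \sum_(i in H) f i + t)%N).

(** A common point would have [f(H) + f(K) > 2 t (r - 1)], but this sum is at most [t r] plus the
    sum over [H :&: K], which is at most [t (r - 2)]. *)
Lemma box_slice_disjoint t H K f : H \in HH -> K \in HH ->
  f \in box_slice t H -> f \in box_slice t K -> H = K.
Proof.
move=> HHH KHH; rewrite !inE => /andP[/eqP sumf fH] /andP[_ fK].
apply/eqP; apply: contraT => /(HHsep HHH KHH) ltHK.
have le1 : (\sum_(i in H) f i + \sum_(i in K) f i
    <= \sum_i f i + \sum_(i in H :&: K) f i)%N.
  rewrite big_mkcond [X in (_ + X <= _)%N]big_mkcond [X in (_ <= _ +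
    X)%N]big_mkcond.
  rewrite -!big_split /=; apply: leq_sum => i _; rewrite inE.
  by case: (i \in H); case: (i \in K); rewrite /= ?addn0 ?add0n.
have le2 : (\sum_(i in H :&: K) f i <= #|H :&: K| * t)%N.
  by rewrite -sum_nat_const; apply: leq_sum => i _; rewrite -ltnS.
have le3 : (#|H :&: K| * t + 2 * t <= t * r)%N.
  by rewrite -mulnDl mulnC leq_mul2l addn2 ltHK orbT.
rewrite sumf in le1; move: le1 le2 le3 fH fK.
move: (\sum_(i in H) f i)%N (\sum_(i in K) f i)%N (\sum_(i in _) f i)%N => a b c.
by move: (#|H :&: K| * t)%N (t * r)%N => d e; lia.
Qed.

(** By disjointness a point of the dilated hypersimplex violates at most one hyperplane
    inequality. *)
Lemma card_lattice_box t :
  (#|lattice_box r HH t| + \sum_(H in HH) #|box_slice t H|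
    = #|finset (fun f : {ffun 'I_n -> 'I_t.+1} => \sum_i f i == t * r)|)%N.
Proof.
under eq_bigr do rewrite -sum1_card big_mkcond /=.
rewrite exchange_big -!sum1_card big_mkcond -big_split [RHS]big_mkcond /=.
apply: eq_bigr => f _; rewrite !inE; case: eqP => sumf /=; last first.
  by apply: big1 => H _; rewrite inE; case: eqP sumf.
case: (boolP [forall H in HH, _]) => [/forall_inP Hle|].
  by rewrite big1 // => H /Hle; rewrite inE ltnNge => ->; rewrite andbF.
rewrite negb_forall => /existsP[H]; rewrite negb_imply -ltnNge => /andP[HHH fH].
have fS : f \in box_slice t H by rewrite inE sumf eqxx.
rewrite (bigD1 H) //= fS big1 // => K /andP[KHH neq].
case: ifP => // fK; case/eqP: neq; exact: (box_slice_disjoint KHH HHH fK fS).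
Qed.

Variable R : realType.

Lemma slices_poly : (forall H, H \in HH -> 0 < #|~: H|)%N ->
  (HH != finset.set0 -> 0 < r)%N ->
  exists2 p : {poly R}, (forall d, 0 <= p`_d)
    & forall t, p.[t%:R] = \sum_(H in HH) #|box_slice t H|%:R.
Proof.
move=> HHC r_gt0; have {r_gt0} r_gt0 : forall H, H \in HH -> (0 < r)%N.
  by move=> H HHH; apply: r_gt0; apply/finset.set0Pn; exists H.
have slice_p H : H \in HH -> exists2 p : {poly R}, (forall d, 0 <= p`_d)
    & forall t, p.[t%:R] = #|box_slice t H|%:R.
  (* Predecessors, as [slice_poly] concerns [m.+1] outside elements and rank [r.+1]. *)
  move=> HHH; have [p p0 pE] := slice_poly R #|~: H|.-1 #|H| r.-1.
  exists p => // t; rewrite pE prednK ?HHC // -card_box_slice.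
  by rewrite prednK // (r_gt0 H).
suff [p p0 pE] : exists2 p : {poly R}, (forall d, 0 <= p`_d)
    & forall t, p.[t%:R] = \sum_(H <- enum HH) #|box_slice t H|%:R.
  by exists p => // t; rewrite pE big_enum.
have : {subset enum HH <= HH} by move=> H; rewrite mem_enum.
elim: (enum HH) => [|H s IH] sHH.
  by exists 0 => [d|t]; rewrite ?coef0 // horner0 big_nil.
have [|p p0 pE] := IH; first by move=> K Ks; apply: sHH; rewrite inE Ks orbT.
have [|q q0 qE] := slice_p H; first by apply: sHH; rewrite inE eqxx.
exists (q + p) => [d|t]; first by rewrite coefD addr_ge0.
by rewrite hornerD pE qE big_cons.
Qed.

Variable M : matroid n.
Hypothesis basesE : forall B, (B \in bases M) = sparse_basis r HH B.

Lemma sparse_ehrhart (pU pS : {poly R}) :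
  (forall t, pU.[t%:R] = (boxpoly R t ^+ n)`_(t * r)) ->
  (forall t, pS.[t%:R] = \sum_(H in HH) #|box_slice t H|%:R) ->
  is_ehrhart_poly (base_polytope M) (pU - pS).
Proof.
move=> UE SE t; exists #|lattice_box r HH t|; first exact: card_lattice_points.
rewrite hornerD hornerN UE SE -card_box -card_lattice_box natrD natr_sum.
by rewrite addrK.
Qed.
End Slices.

(** * Comparison with the uniform matroid *)

Theorem theorem1p4 (R : realType) (n r : nat) (M : matroid n)
    (rM : mrank M = r) (pM : paving M) :
  coef_le (ehr R M) (ehr R (uniform_matroid (mrank_bound rM))).
Proof.
have [pU pUE] := hypersimplex_poly R (mrank_bound rM).
have sep H K : H \in stressed M -> K \in stressed M -> H != K ->
    (#|H :&: K|.+1 < r)%N by rewrite -rM; exact: stressed_sep.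
have [||pS pS0 pSE] := @slices_poly n r (stressed M) R.
- exact: card_stressedC.
(* A stressed set contains no basis, so the empty set is not a basis and the rank is positive. *)
- move=> /finset.set0Pn[H HS]; have /finset.set0Pn[B BM] := bases_neq0 M.
  rewrite -rM -(card_basis BM) card_gt0.
  by apply: contraNneq (stressed_basis_free HS BM) => ->; exact: finset.sub0set.
have -> : ehr R M = pU - pS.
  apply/ehrhart_polyE/(sparse_ehrhart sep) => // B.
  by rewrite bases_stressed rM.
have -> : ehr R (uniform_matroid (mrank_bound rM)) = pU.
  (* The uniform matroid is the case of an empty family, whose slice polynomial is 0. *)
  rewrite -[RHS]subr0; apply/ehrhart_polyE.
  apply: (@sparse_ehrhart n r finset.set0) => // [H K|B|t].
  - by rewrite inE.
  - rewrite inE /sparse_basis; case: eqP => //= _; apply/esym/forall_inP => H.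
    by rewrite inE.
  - by rewrite horner0 big_set0.
by move=> d; rewrite coefB gerBl.
Qed.
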